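(* Let $n$ and $j$ be integers with $4\le j\le n$, and let $\varphi$ be an edge-coloring of $K_n$ with at least three colors such that every cycle of length $j$ in $K_n$ gets all colors. Then every cycle in $K_n$ of length at least $j$ gets all colors under $\varphi$.
   Context: $K_n$ is the complete graph on $n$ vertices. A cycle ''gets all colors'' if every color that appears on some edge of $K_n$ under $\varphi$ appears on some edge of the cycle; ''at least three colors'' means that at least three colors appear on the edges of $K_n$. *)

(* Defs.v *)
From mathcomp Require Import all_boot.

Set Implicit Arguments.
Unset Strict Implicit.
Unset Printing Implicit Defensive.

Definition edge (n : nat) := {e : {set 'I_n} | #|e| == 2}.

Definition adjacent (n : nat) : rel 'I_n := [rel x y | x != y].

(* A cycle is given by its vertices in cyclic order, so its length is [size c];
   [2 < size c] discards the 2-vertex sequences that [ucycleb] accepts. *)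
Definition is_cycle (n : nat) (c : seq 'I_n) : bool :=
  ucycleb (@adjacent n) c && (2 < size c).

Definition cycle_edge (n : nat) (c : seq 'I_n) : pred (edge n) :=
  [pred e | [exists x in c, val e == [set x; next c x]]].

Definition colors (n : nat) (C : eqType) (phi : edge n -> C) : seq C :=
  undup (codom phi).

Definition gets_all_colors (n : nat) (C : eqType) (phi : edge n -> C)
    (c : seq 'I_n) : Prop :=
  forall a : C, a \in colors phi -> exists2 e : edge n, cycle_edge c e & phi e = a.

(* Main.v *)
Require Import Defs.
From mathcomp Require Import all_boot.
From mathcomp Require Import zify.

Set Implicit Arguments.
Unset Strict Implicit.
Unset Printing Implicit Defensive.

(** It suffices to pass from cycles of length [j] to cycles of length
    [N = j + 1].  Suppose that a cycle [w 0, ..., w (N - 1)] avoids a color [R]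
    and let [B], [G] be two further colors; indices are read modulo [N].  Each
    step below picks a [j]-cycle on these vertices most of whose edges are known
    and uses that it shows all three colors.

    - Leaving out [w (i + 1)] gives a cycle whose only new edge is the chord
      [w i, w (i + 2)], so all chords of span 2 have color [R]
      ([chord2_color]).
    - Two strands of span-2 chords, running along the odd and the even
      positions, zigzag around all vertices but one.  Only the two links between
      the strands can show [B] and [G], and these are edges [w i, w (i + 1)] and
      [w (i + 3), w (i + 4)].  Hence every cycle edge is [B] or [G], and the two
      tones swap every third step ([zigzag_color], [b_add3]).  Going around
      three times shows that [N] is even ([N_even]).
    - For [N] even, each strand closes up to a cycle on its parity class, which
      leaves more freedom in choosing the links.  One such [j]-cycle forces the
      color of all span-3 chords ([chord3_color]).
    - A strand may also contain one span-4 chord.  Two such [j]-cycles, with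
      span-3 chords as links, would force that chord to be both [B] and [G] if
      [w i, w (i + 1)] and [w (i + 2), w (i + 3)] had the same tone
      ([chord4_color_low], [chord4_color_high]).  So tones swap every second
      step ([b_add2_succ]).

    Over six steps the tone is then swapped twice and also three times, a
    contradiction. *)

(** * Cycles made of two strands *)

Lemma cycle_mkseq2 (T : Type) (e : rel T) (f g : nat -> T) (p q : nat) :
  (forall t, t < p -> e (f t) (f t.+1)) ->
  (forall t, t < q -> e (g t) (g t.+1)) ->
  e (f p) (g 0) -> e (g q) (f 0) ->
  cycle e (mkseq f p.+1 ++ mkseq g q.+1).
Proof.
have mkseq_path h r : (forall t, t < r -> e (h t) (h t.+1)) ->
    path e (h 0) (mkseq (h \o succn) r) /\
    last (h 0) (mkseq (h \o succn) r) = h r.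
  elim: r => [|r IHr] // er; have [|pr lr] := IHr; first by move=> t /ltnW/er.
  by rewrite mkseqS rcons_path last_rcons pr lr er.
have consE h r : mkseq h r.+1 = h 0 :: mkseq (h \o succn) r.
  by rewrite /mkseq /= (iotaDl 1 0) -map_comp.
move=> /mkseq_path[pf lf] /mkseq_path[pg lg] efg egf.
by rewrite !consE /= rcons_cat /= cat_path pf /= lf efg rcons_path pg lg egf.
Qed.

Lemma modn_inj_window (N lo i k : nat) :
  lo <= i < lo + N -> lo <= k < lo + N -> i = k %[mod N] -> i = k.
Proof.
move=> /andP[li iN] /andP[lk kN] /eqP.
rewrite -(subnKC li) -(subnKC lk) eqn_modDl !modn_small ?ltn_subLR //.
by move=> /eqP->.
Qed.

(** * A cycle avoiding a color that all cycles one shorter show *)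

(** The vertices of the long cycle are given by a sequence [w] of period [N], so
    that a position can be moved by any offset and symmetric copies of a
    statement need no rotation of the cycle. *)
Section LongCycle.

Variables (V D : eqType) (col : V -> V -> D) (N : nat) (w : nat -> V).
Variables (R B G : D).

Hypothesis col_sym : forall x y, col x y = col y x.
Hypothesis N_ge5 : 4 < N.
Hypothesis w_mod : forall i k, w i = w k <-> i = k %[mod N].
Hypothesis RBG_uniq : uniq [:: R; B; G].
Hypothesis short_cycle : forall (s : seq V) (a : D),
  uniq s -> size s = N.-1 -> a \in [:: R; B; G] ->
  ~~ cycle [rel x y | col x y != a] s.

Let c i := col (w i) (w i.+1).

Hypothesis c_neqR : forall i, c i != R.

Lemma w_addN i : w (i + N) = w i.
Proof. by apply/w_mod; rewrite modnDr. Qed.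

Lemma c_addN i : c (i + N) = c i.
Proof. by rewrite /c -addSn !w_addN. Qed.

(** The only way colors are forced: when every edge of a closed pair of strands
    except the last link avoids [a], the last link has color [a].  Asking that
    all positions lie in one window of length [N] makes distinctness of the
    vertices a matter of linear arithmetic on positions. *)
Lemma two_strands_last_color (a : D) (lo : nat) (F H : nat -> nat) (p q : nat)
    (f0 fp h0 hq : nat) :
  a \in [:: R; B; G] -> p + q = N - 3 ->
  (forall t, t <= p -> lo <= F t < lo + N) ->
  (forall t, t <= q -> lo <= H t < lo + N) ->
  (forall t u, t <= p -> u <= p -> F t = F u -> t = u) ->
  (forall t u, t <= q -> u <= q -> H t = H u -> t = u) ->
  (forall t u, t <= p -> u <= q -> F t <> H u) ->
  (forall t, t < p -> col (w (F t)) (w (F t.+1)) != a) ->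
  (forall t, t < q -> col (w (H t)) (w (H t.+1)) != a) ->
  F 0 = f0 -> F p = fp -> H 0 = h0 -> H q = hq ->
  col (w fp) (w h0) != a -> col (w hq) (w f0) = a.
Proof.
move=> aRBG pq winF winH injF injH FH eF eH <- <- <- <- eFH.
apply/eqP/negPn/negP => eHF.
have w_inj i k : lo <= i < lo + N -> lo <= k < lo + N -> w i = w k -> i = k.
  by move=> wi wk /w_mod; apply: modn_inj_window wi wk.
have := @cycle_mkseq2 V [rel x y | col x y != a] (w \o F) (w \o H) p q
          eF eH eFH eHF.
apply/negP/short_cycle => //; last by rewrite size_cat !size_mkseq; lia.
rewrite cat_uniq; apply/and3P; split.
- apply/mkseq_uniqP => t u; rewrite !inE !ltnS => tp up /w_inj E.
  by apply: injF => //; apply: E; apply: winF.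
- apply/hasPn => x /mapP[u]; rewrite mem_iota add0n ltnS => uq ->.
  apply/mapP => -[t]; rewrite mem_iota add0n ltnS => tp /w_inj E.
  by apply: (FH t u) => //; apply/esym/E; [apply: winH | apply: winF].
- apply/mkseq_uniqP => t u; rewrite !inE !ltnS => tq uq /w_inj E.
  by apply: injH => //; apply: E; apply: winH.
Qed.

(** The first strand is the path from [w (i + 2)] forward to [w (i - 1)], the
    second one the single vertex [w i]. *)
Lemma chord2_color i : col (w i) (w (i + 2)) = R.
Proof.
apply: (@two_strands_last_color R i (fun t => i + 2 + t) (fun=> i) (N - 3) 0
          (i + 2) (i + N.-1) i i);
  rewrite ?inE ?eqxx //; try by move=> *; lia.
- by move=> t _; rewrite /= (addnS _ t) -/(c _) c_neqR.
- rewrite -(w_addN i); have -> : i + N = (i + N.-1).+1 by lia.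
  exact: c_neqR.
Qed.

Lemma mem_BG_RBG a : a \in [:: B; G] -> a \in [:: R; B; G].
Proof. by rewrite !inE => ->; rewrite orbT. Qed.

Lemma R_neq_BG a : a \in [:: B; G] -> R != a.
Proof.
by move=> aBG; case/andP: RBG_uniq => + _; apply: contraNneq => ->.
Qed.

Lemma chord2_avoids a i k : a \in [:: B; G] -> k = i + 2 \/ i = k + 2 ->
  col (w i) (w k) != a.
Proof.
move=> /R_neq_BG + [->|->]; first by rewrite chord2_color.
by rewrite col_sym chord2_color.
Qed.

(** Leaving out [w (i + 2)], one strand goes up through [i + 3, i + 5, ...] and
    the other comes down through [..., i + 6, i + 4].  They are linked at the
    top by [w i, w (i + 1)], traversed in a direction that depends on the parity
    of [N], and at the bottom by [w (i + 3), w (i + 4)]. *)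
Lemma zigzag_color i a : a \in [:: B; G] -> c i != a -> c (i + 3) = a.
Proof.
move=> aBG cia; rewrite /c col_sym -addnS.
have [oN|eN] := boolP (odd N).
  apply: (@two_strands_last_color a (i + 3) (fun t => i + 3 + t.*2)
    (fun t => i + 4 + ((N.-1)./2.-1 - t).*2) (N./2.-1) ((N.-1)./2.-1)
    (i + 3) (i + N) (i + N).+1 (i + 4));
  rewrite ?mem_BG_RBG //; try by move=> *; lia.
  - by move=> t _; apply: chord2_avoids => //; lia.
  - by move=> t ?; apply: chord2_avoids => //; lia.
  - by rewrite -/(c _) c_addN.
apply: (@two_strands_last_color a (i + 3) (fun t => i + 3 + t.*2)
    (fun t => i + 4 + ((N.-1)./2.-1 - t).*2) (N./2.-1) ((N.-1)./2.-1)
    (i + 3) (i + N).+1 (i + N) (i + 4));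
  rewrite ?mem_BG_RBG //; try by move=> *; lia.
- by move=> t _; apply: chord2_avoids => //; lia.
- by move=> t ?; apply: chord2_avoids => //; lia.
- by rewrite col_sym -/(c _) c_addN.
Qed.

Lemma B_neq_G : B != G.
Proof. by case/and3P: RBG_uniq => _; rewrite inE. Qed.

Lemma c_BG i : c i \in [:: B; G].
Proof.
rewrite -c_addN; have -> : i + N = i + (N - 3) + 3 by lia.
have [cB|/zigzag_color->] := eqVneq (c (i + (N - 3))) B; rewrite ?mem_head //.
by rewrite (@zigzag_color _ G) ?inE ?eqxx ?orbT // cB B_neq_G.
Qed.

Let b i := c i == B.

Lemma c_tone i : c i = if b i then B else G.
Proof. by rewrite /b; have := c_BG i; rewrite !inE; case: eqP => //= _ /eqP. Qed.

Lemma tone_BG (d : bool) : (if d then B else G) \in [:: B; G].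
Proof. by rewrite !inE; case: d; rewrite eqxx ?orbT. Qed.

Lemma tone_neq (d d' : bool) :
  ((if d then B else G) != (if d' then B else G)) = (d != d').
Proof.
by have BG := B_neq_G; case: d d' => [] []; rewrite ?eqxx ?(eq_sym G) ?BG.
Qed.

Lemma b_add3 i : b (i + 3) = ~~ b i.
Proof.
rewrite {1}/b; have [bi|nbi] /= := boolP (b i).
  rewrite (@zigzag_color _ G) ?inE ?eqxx ?orbT ?(eq_sym G) ?(negPf B_neq_G) //.
  by rewrite (eqP bi) B_neq_G.
by rewrite (@zigzag_color _ B) ?mem_head ?eqxx.
Qed.

Lemma b_addN i : b (i + N) = b i.
Proof. by rewrite /b c_addN. Qed.

(** [3 * N] steps flip the tone [N] times, and bring it back. *)
Lemma N_even : ~~ odd N.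
Proof.
have b3 t : b (t * 3) = odd t (+) b 0.
  by elim: t => // t IHt; rewrite mulSnr b_add3 IHt /= addNb.
have bN t : b (t * N) = b 0 by elim: t => // t IHt; rewrite mulSnr b_addN.
by have := b3 N; rewrite mulnC bN; case: odd; case: (b 0).
Qed.

(** The strands [i + 3, i + 5, ..., i + N - 1] and [i + N - 2, ..., i + 2, i],
    which leave out [w (i + 1)], are linked by one cycle edge, of tone opposite
    to that of [c (i + 1)], and by the chord [w i, w (i + 3)]. *)
Lemma chord3_color i : col (w i) (w (i + 3)) = c (i + 1).
Proof.
have eN := N_even.
apply: (@two_strands_last_color (c (i + 1)) i (fun t => i + 3 + t.*2)
    (fun t => i + (N./2.-1 - t).*2) (N./2 - 2) (N./2.-1)
    (i + 3) (i + N.-1) (i + (N - 2)) i);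
  rewrite ?mem_BG_RBG ?c_BG //; try by move=> *; lia.
- by move=> t _; apply: chord2_avoids; rewrite ?c_BG //; lia.
- by move=> t ?; apply: chord2_avoids; rewrite ?c_BG //; lia.
- rewrite col_sym; have -> : i + N.-1 = (i + (N - 2)).+1 by lia.
  rewrite -/(c _) !c_tone tone_neq -(b_addN (i + 1)).
  have -> : i + 1 + N = i + (N - 2) + 3 by lia.
  by rewrite b_add3; case: (b _).
Qed.

(** The strand [i + 3, i + 1, i + 5, i + 7, ...] exchanges its first two
    vertices, so that it contains the span-4 chord.  The other strand goes down
    to [i] and leaves out [w (i - 2)]; the links are span-3 chords with the
    colors of [w (i + 1), w (i + 2)] and [w (i + 3), w (i + 4)]. *)
Lemma chord4_color_low i a : a \in [:: B; G] ->
  c i.+1 != a -> c (i + 3) != a -> col (w i.+1) (w (i + 5)) = a.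
Proof.
have eN := N_even => aBG c1 c3; apply/eqP/negPn/negP => n4.
have /eqP := c1; apply; rewrite -addn1 -chord3_color.
apply: (@two_strands_last_color a i
    (fun t => if t < 2 then i + 1 + (1 - t).*2 else i + 1 + t.*2)
    (fun t => i + (N./2 - 2 - t).*2) (N./2.-1) (N./2 - 2)
    (i + 3) (i + N.-1) (i + (N - 4)) i);
  rewrite ?mem_BG_RBG //; try by move=> *; lia.
- by move=> t; case: ltnP; lia.
- by move=> t u; case: (ltnP t 2); case: (ltnP u 2); lia.
- by move=> t u; case: ltnP; lia.
- move=> [|[|t]] _ /=; last by apply: chord2_avoids => //; lia.
    by apply: chord2_avoids => //; lia.
  by move: n4; congr (col (w _) (w _) != a); lia.
- by move=> t ?; apply: chord2_avoids => //; lia.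
- by case: ltnP; lia.
- by case: ltnP; lia.
- rewrite col_sym; have -> : i + N.-1 = i + (N - 4) + 3 by lia.
  rewrite chord3_color; move: c3; rewrite !c_tone.
  suff -> : b (i + (N - 4) + 1) = b (i + 3) by [].
  rewrite -(b_addN (i + 3)).
  have -> : i + 3 + N = i + (N - 4) + 1 + 3 + 3 by lia.
  by rewrite !b_add3 negbK.
Qed.

(** Here the strand through the span-4 chord is [i + 2, i, i + 4, i + 6, ...] and
    the other one goes down to [i + 5], leaving out [w (i + 3)].  The links have
    the tones opposite to those of [c i] and [c (i + 2)]. *)
Lemma chord4_color_high i a : a \in [:: B; G] ->
  c (i + 3) != a -> c (i + 5) != a -> col (w i) (w (i + 4)) = a.
Proof.
have eN := N_even => aBG c3 c5; apply/eqP/negPn/negP => n4.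
have /eqP := c3; apply; have -> : i + 3 = i + 2 + 1 by lia.
rewrite -chord3_color col_sym -(w_addN (i + 2)).
apply: (@two_strands_last_color a (i + 4)
    (* [i + N] and [i + N + 2] stand for [i] and [i + 2], as the window starts
       at [i + 4]. *)
    (fun t => if t < 2 then i + N + (1 - t).*2 else i + t.*2)
    (fun t => i + 5 + (N./2 - 2 - t).*2) (N./2.-1) (N./2 - 2)
    (i + 2 + N) (i + (N - 2)) (i + N.+1) (i + 2 + 3));
  rewrite ?mem_BG_RBG //; try by move=> *; lia.
- by move=> t; case: ltnP; lia.
- by move=> t u; case: (ltnP t 2); case: (ltnP u 2); lia.
- by move=> t u; case: ltnP; lia.
- move=> [|[|t]] _ /=; last by apply: chord2_avoids => //; lia.
    by apply: chord2_avoids => //; lia.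
  by move: n4; rewrite subnn addn0 w_addN.
- by move=> t ?; apply: chord2_avoids => //; lia.
- by case: ltnP; lia.
- by case: ltnP; lia.
- have -> : i + N.+1 = i + (N - 2) + 3 by lia.
  rewrite chord3_color; move: c5; rewrite !c_tone.
  suff -> : b (i + (N - 2) + 1) = b (i + 5) by [].
  rewrite -(b_addN (i + 5)).
  have -> : i + 5 + N = i + (N - 2) + 1 + 3 + 3 by lia.
  by rewrite !b_add3 negbK.
Qed.

(** If two edges at distance 2 had the same tone, the span-4 chord starting at
    the first one would be forced to have both tones. *)
Lemma b_add2_succ i : b (i + 3) = ~~ b i.+1.
Proof.
have [E|] := eqVneq (b (i + 3)) (b i.+1); last by case: (b _); case: (b _).
have b4 : b (i.+1 + 3) = ~~ b i.+1 by rewrite b_add3.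
have b6 : b (i.+1 + 5) = ~~ b i.+1.
  by have -> : i.+1 + 5 = i + 3 + 3 by [lia]; rewrite b_add3 E.
have low := @chord4_color_low i _ (tone_BG (~~ b i.+1)).
have := @chord4_color_high i.+1 _ (tone_BG (b i.+1)).
have -> : i.+1 + 4 = i + 5 by lia.
rewrite low ?c_tone ?b4 ?b6 ?E ?tone_neq; try by case: (b i.+1).
move=> high; have /eqP : (if ~~ b i.+1 then B else G) = if b i.+1 then B else G.
  by apply: high; case: (b i.+1).
by apply: contraTeq => _; rewrite tone_neq; case: (b i.+1).
Qed.

Lemma no_redless_cycle : False.
Proof.
have := b_add2_succ 4; rewrite (b_add3 4) (b_add3 1) (b_add2_succ 2 : b 5 = _).
by rewrite (b_add2_succ 0 : b 3 = _); case: (b 1).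
Qed.

End LongCycle.

(** * Lengthening by one vertex *)

Lemma next_nth_mod (T : eqType) (x0 : T) (s : seq T) (k : nat) :
  uniq s -> k < size s -> next s (nth x0 s k) = nth x0 s (k.+1 %% size s).
Proof.
move=> Us ks; rewrite next_nth mem_nth // index_uniq //.
case: s Us ks => [//|y s] _ /=; rewrite ltnS leq_eqVlt => /orP[/eqP->|ks].
  by rewrite modnn nth_default.
by rewrite modn_small //=; apply: set_nth_default.
Qed.

Section Extension.

Variables (V D : eqType) (col : V -> V -> D).

Lemma cycle_color_extend (j : nat) (R B G : D) (s : seq V) :
  (forall x y, col x y = col y x) -> 3 < j -> uniq [:: R; B; G] ->
  (forall (s' : seq V) a, uniq s' -> size s' = j -> a \in [:: R; B; G] ->
     ~~ cycle [rel x y | col x y != a] s') ->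
  uniq s -> size s = j.+1 -> ~~ cycle [rel x y | col x y != R] s.
Proof.
move=> col_sym j4 RBG hit Us sz; apply/negP => noR.
have [x0 _] : exists x0, x0 \in s.
  by case: s sz {Us noR} => // x s _; exists x; apply: mem_head.
pose w i := nth x0 s (i %% j.+1).
have modlt i : i %% j.+1 < size s by rewrite sz ltn_pmod.
apply: (@no_redless_cycle V D col j.+1 w R B G) => //.
- move=> i k; split=> [/eqP|E]; last by rewrite /w E.
  by rewrite nth_uniq // => /eqP.
- move=> i; have := next_cycle noR (mem_nth x0 (modlt i)).
  rewrite next_nth_mod // sz /w; congr (col _ (nth _ _ _) != R).
  by rewrite -(addn1 (i %% _)) modnDml addn1.
Qed.

End Extension.

(** * Edge colorings as colorings of pairs of vertices *)

Section EdgeColoring.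

Variables (n : nat) (C : eqType) (phi : edge n -> C).

(** The color of the edge [xy], with [None] for [x = y]. *)
Definition pair_color (x y : 'I_n) : option C :=
  omap phi (insub [set x; y]).

Lemma pair_colorC x y : pair_color x y = pair_color y x.
Proof. by rewrite /pair_color setUC. Qed.

(** Since [cycle] tests a relation along consecutive vertices, a cycle misses the
    color [a] exactly when it is a cycle of the relation of not having color
    [a]. *)
Lemma gets_all_colorsP (c : seq 'I_n) : uniq c ->
  gets_all_colors phi c <->
  (forall a, a \in colors phi ->
     ~~ cycle [rel x y | pair_color x y != Some a] c).
Proof.
move=> Uc; split=> [all_c a /all_c[e /exists_inP[x xc /eqP ex] <-]|meets a aC].
  apply/negP => /next_cycle/(_ xc) /=.
  by rewrite /pair_color -ex valK eqxx.
have /negP no_cycle := meets a aC.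
have [/exists_inP[x xc] | none] :=
    boolP [exists x in c, pair_color x (next c x) == Some a].
  rewrite /pair_color; case: insubP => //= e _ ex /eqP[ea].
  by exists e => //; apply/exists_inP; exists x => //; apply/eqP.
case: no_cycle; apply: cycle_from_next => // x xc /=.
by apply: contraNneq none => E; apply/exists_inP; exists x; rewrite ?E.
Qed.

Lemma uniq_is_cycle (c : seq 'I_n) : uniq c -> 2 < size c -> is_cycle c.
Proof.
move=> Uc sz; rewrite /is_cycle /ucycleb Uc sz !andbT.
apply: cycle_from_next => // x xc /=.
have [i c' Ec] := rot_to xc; rewrite -(next_rot i Uc) Ec.
move: (rot_uniq i c) (size_rot i c); rewrite Ec Uc.
case: c' {Ec} => [/= _ E|y c' /=]; first by rewrite -E in sz.
by rewrite eqxx inE negb_or => /and3P[/andP[]].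
Qed.

End EdgeColoring.

(** * All long cycles *)

Theorem theorem2p6 (n j : nat) (C : eqType) (phi : edge n -> C) :
  4 <= j <= n ->
  3 <= size (colors phi) ->
  (forall c : seq 'I_n, is_cycle c -> size c = j -> gets_all_colors phi c) ->
  forall c : seq 'I_n, is_cycle c -> j <= size c -> gets_all_colors phi c.
Proof.
move=> /andP[j4 _] c3 short c0 cyc0 jc0.
have /andP[/andP[_ Uc0] _] := cyc0; apply/gets_all_colorsP => //.
have {short} base c : uniq c -> size c = j -> forall a, a \in colors phi ->
    ~~ cycle [rel x y | pair_color phi x y != Some a] c.
  move=> Uc sz; apply/gets_all_colorsP => //; apply: short => //.
  by apply: uniq_is_cycle; rewrite // sz; lia.
move: {cyc0} c0 Uc0 jc0.
suff long d c : uniq c -> size c = j + d -> forall a, a \in colors phi ->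
    ~~ cycle [rel x y | pair_color phi x y != Some a] c.
  by move=> c Uc jc; apply: (long (size c - j)) => //; rewrite subnKC.
elim: d c => [|d IHd] c Uc; first by rewrite addn0; apply: base.
rewrite addnS => sz R /rot_to[i [|B [|G s]] Es];
  try by move: c3; rewrite -(size_rot i) Es.
have UC : uniq (rot i (colors phi)) by rewrite rot_uniq undup_uniq.
have inC a : a \in [:: R; B; G] -> a \in colors phi.
  rewrite -(mem_rot i (colors phi)) Es -[[:: R, B, G & s]]/([:: R; B; G] ++ s).
  rewrite mem_cat.
  by move=> ->.
apply: (@cycle_color_extend _ _ _ (j + d) (Some R) (Some B) (Some G)) => //.
- exact: pair_colorC.
- by lia.
- move: UC; rewrite Es -[[:: R, B, G & s]]/([:: R; B; G] ++ s) cat_uniq.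
  by case/and3P => URBG _ _; rewrite -(map_inj_uniq (@Some_inj _)) in URBG.
- move=> s' _ Us' sz' /(mapP (s := [:: R; B; G]) (f := Some))[a aRBG ->].
  by apply: IHd => //; apply: inC.
Qed.
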